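(* Let $a\in\mathbb{N}$ (with $0\in\mathbb{N}$). Then, in any summable set $\mathcal{U}$ such that $\mathbf{S}(\mathcal{U})$ contains the function $x\mapsto x^a$, it follows that $$\mathrm{ess}(x\mapsto x^a)=B_a,$$ where $\mathrm{ess}$ is the essence relative to $\mathcal{U}$ and $B_a$ are the Bernoulli numbers with the convention $B_1=\tfrac12$.
   Context: Sets of functions. $\mathbb{C}^{\mathbb{C}}$ is the set of all functions $\mathbb{C}\to\mathbb{C}$; $x\mapsto x^0$ is the constant function $1$. For $X\subset\mathbb{C}^{\mathbb{C}}$: $\mathbf{L}(X)$ is the set of all (finite, complex) linear combinations of functions in $X$; $\mathbf{T}(X)$ is the set of all translates $x\mapsto g(x+c)$ with $g\in X$, $c\in\mathbb{C}$; and $\mathbf{S}(X):=\mathbf{L}(\mathbf{T}(X))$. Polynomial sums. For a complex polynomial $p$, let $P$ be the unique polynomial with $P(z)-P(z-1)=p(z)$ for all $z$ and $P(0)=0$; the fractional sum of $p$ from $x$ to $y$ is $P(y)-P(x-1)$, for $x,y\in\mathbb{C}$. Fractional summable functions. $f:\mathbb{C}\to\mathbb{C}$ is fractional summable if there are a degree bound $m$ and a sequence $(p_n)_{n\in\mathbb{N}}$ of polynomials of degree $\le m$ (the null polynomial has degree $-\infty$) such that $|f(n+x)-p_n(n+x)|\to 0$ as $n\to\infty$ for all $x\in\mathbb{C}$, and such that for all $x,y\in\mathbb{C}$ the limit as $n\to\infty$ of (fractional sum of $p_n$ from $n+x$ to $n+y$) $+\sum_{\nu=1}^n\bigl(f(\nu+x-1)-f(\nu+y)\bigr)$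 exists. $\mathcal{F}$ is the set of functions $\mathbb{C}\to\mathbb{C}$ that are linear combinations of holomorphic (entire) functions and fractional summable functions. Summable sets. A set $\mathcal{U}\subset\mathcal{F}$ is a summable set if there is a unique map $\Sigma_{\mathcal{U}}:\mathbf{S}(\mathcal{U})\times\mathbb{C}^2\to\mathbb{C}$, $(f,x,y)\mapsto\Sigma_{\mathcal{U}}(f;x,y)$ (thought of as ''$\sum_{k=x}^y f(k)$''), satisfying, for all $f,g\in\mathbf{S}(\mathcal{U})$ and $x,y,z,s,\lambda,\mu\in\mathbb{C}$: (A1) $\Sigma_{\mathcal{U}}(f;x,y)+\Sigma_{\mathcal{U}}(f;y+1,z)=\Sigma_{\mathcal{U}}(f;x,z)$; (A2) $\Sigma_{\mathcal{U}}(f;x+s,y+s)=\Sigma_{\mathcal{U}}(h;x,y)$ where $h(t)=f(t+s)$; (A3) $\Sigma_{\mathcal{U}}(\lambda f+\mu g;x,y)=\lambda\Sigma_{\mathcal{U}}(f;x,y)+\mu\Sigma_{\mathcal{U}}(g;x,y)$; (A4) $\Sigma_{\mathcal{U}}(f;1,1)=f(1)$; (A5* ) if $f$ is holomorphic, then $x\mapsto\Sigma_{\mathcal{U}}(f;1,x)$ is holomorphic on $\mathbb{C}$; (A6) if $\lim_{n\to\infty}f(t+n)=0$ for every $t\in\mathbb{C}$, then $\lim_{n\to\infty}\Sigma_{\mathcal{U}}(f(\cdot+n);x,y)=0$; moreover, if there is a sequence $(p_n)$ of polynomials of fixed degree (independent of $n$) with $|f(t+n)-p_n(t+n)|\to0$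 for all $t\in\mathbb{C}$, then $\Sigma_{\mathcal{U}}(f(\cdot+n);x,y)$ minus the fractional sum of the polynomial $p_n(\cdot+n)$ from $x$ to $y$ tends to $0$ as $n\to\infty$. The map $\Sigma_{\mathcal{U}}$ is called the fractional sum relative to $\mathcal{U}$. Essence. For $f\in\mathbf{S}(\mathcal{U})$, the essence of $f$ relative to $\mathcal{U}$ is $\mathrm{ess}(f):=\lim_{h\to0}\frac1h\Sigma_{\mathcal{U}}(f;1,h)$ ($h\in\mathbb{C}\setminus\{0\}$), if the limit exists; then $f$ is said to be a function with essence in $\mathcal{U}$. *)

(* Defs.v *)
From HB Require Import structures.
From mathcomp Require Import all_boot all_order all_algebra.
From mathcomp Require Import complex.
From mathcomp Require Import all_classical all_reals all_analysis.

Set Implicit Arguments.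
Unset Strict Implicit.
Unset Printing Implicit Defensive.

Import Order.TTheory GRing.Theory Num.Theory.
Import numFieldNormedType.Exports.

Local Open Scope classical_set_scope.
Local Open Scope ring_scope.

(* R[i] packed as a numClosedFieldType, so that it carries the topology that
   MathComp-Analysis attaches to such fields.  The norm is valued in Cplx R. *)
Definition Cplx (R : realType) : numClosedFieldType := R[i].

(* bernoulli_seq n = [:: B_0; ...; B_(n-1)], with the convention B_1 = 1/2:
   the recurrence is bernoulliP below. *)
Fixpoint bernoulli_seq (n : nat) : seq rat :=
  if n is m.+1 then
    let s := bernoulli_seq m in
    rcons s (1 - (m.+1%:R)^-1 * \sum_(k < m) 'C(m.+1, k)%:R * s`_k)
  else [::].

Definition bernoulli (n : nat) : rat := (bernoulli_seq n.+1)`_n.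

Lemma size_bernoulli_seq n : size (bernoulli_seq n) = n.
Proof. by elim: n => //= n IHn; rewrite size_rcons IHn. Qed.

Lemma nth_bernoulli_seq n k :
  (k < n)%N -> (bernoulli_seq n)`_k = bernoulli k.
Proof.
elim: n => // n IHn; rewrite ltnS leq_eqVlt => /predU1P[-> //|kn].
by rewrite /= nth_rcons size_bernoulli_seq kn IHn.
Qed.

Lemma bernoulliP n :
  \sum_(k < n.+1) 'C(n.+1, k)%:R * bernoulli k = n.+1%:R.
Proof.
rewrite big_ord_recr /= {2}/bernoulli /= nth_rcons size_bernoulli_seq ltnn eqxx.
rewrite binSn mulrBr mulr1 mulrA divff ?pnatr_eq0// mul1r.
rewrite (eq_bigr (fun k : 'I_n => 'C(n.+1, k)%:R * (bernoulli_seq n)`_k)).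
  by rewrite addrC subrK.
by move=> k _; rewrite nth_bernoulli_seq.
Qed.

Lemma bernoulli1 : bernoulli 1 = 2%:R^-1.
Proof.
have := bernoulliP 1; have := bernoulliP 0.
rewrite !big_ord_recr !big_ord0 /= !add0r => h0; rewrite -/(bernoulli 0).
have {h0}-> : bernoulli 0 = 1 by rewrite -[LHS]mul1r h0.
rewrite mulr1 => h; apply: (@mulfI _ 2%:R) => //.
by rewrite mulfV //; apply: (@addrI _ 1); rewrite h.
Qed.

Section FractionalSums.
Variable R : realType.
Local Notation C := (Cplx R).

Definition lin_span (X : set (C -> C)) : set (C -> C) :=
  [set f | exists (n : nat) (c : 'I_n -> C) (g : 'I_n -> C -> C),
     (forall i, X (g i)) /\ f = (fun x => \sum_(i < n) c i * g i x)].

Definition translates (X : set (C -> C)) : set (C -> C) :=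
  [set f | exists (g : C -> C) (c : C), X g /\ f = (fun x => g (x + c))].

Definition trans_span (X : set (C -> C)) : set (C -> C) :=
  lin_span (translates X).

Definition entire (f : C -> C) : Prop := forall z : C, derivable f z 1.

Definition psum_primitive (p : {poly C}) : {poly C} :=
  xget 0 [set P : {poly C} |
    (forall z : C, P.[z] - P.[z - 1] = p.[z]) /\ P.[0] = 0].

Definition psum (p : {poly C}) (x y : C) : C :=
  (psum_primitive p).[y] - (psum_primitive p).[x - 1].

(* size p = deg p + 1, and size 0 = 0. *)
Definition fractional_summable (f : C -> C) : Prop :=
  exists (m : nat) (p : nat -> {poly C}),
    [/\ forall n, (size (p n) <= m.+1)%N,
        forall x : C,
          `|f (n%:R + x) - (p n).[n%:R + x]| @[n --> \oo] --> (0 : C)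
      & forall x y : C,
          cvgn (fun n : nat =>
            (psum (p n) (n%:R + x) (n%:R + y)
             + \sum_(1 <= nu < n.+1) (f (nu%:R + x - 1) - f (nu%:R + y)) : C))].

Definition classF : set (C -> C) :=
  lin_span ([set f | entire f] `|` [set f | fractional_summable f]).

(* A map S(U) x C^2 -> C is encoded as a total function whose values are only
   constrained (and compared, in summable_set) on S(U) = trans_span U.
   In A6, "fixed degree" is the same size d for every p n (d = 0 being the null
   polynomials). *)
Record is_fsum (U : set (C -> C)) (Sg : (C -> C) -> C -> C -> C) : Prop :=
  IsFsum {
    fsum_A1 : forall f (x y z : C), trans_span U f ->
      Sg f x y + Sg f (y + 1) z = Sg f x z;
    fsum_A2 : forall f (x y s : C), trans_span U f ->
      Sg f (x + s) (y + s) = Sg (fun t => f (t + s)) x y;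
    fsum_A3 : forall f g (x y lam mu : C), trans_span U f -> trans_span U g ->
      Sg (fun t => lam * f t + mu * g t) x y = lam * Sg f x y + mu * Sg g x y;
    fsum_A4 : forall f, trans_span U f -> Sg f 1 1 = f 1;
    fsum_A5 : forall f, trans_span U f -> entire f -> entire (Sg f 1);
    fsum_A6 : forall f (x y : C), trans_span U f ->
      (forall t : C, f (t + n%:R) @[n --> \oo] --> (0 : C)) ->
      Sg (fun t => f (t + n%:R)) x y @[n --> \oo] --> (0 : C);
    fsum_A6_poly : forall f (x y : C) (d : nat) (p : nat -> {poly C}),
      trans_span U f ->
      (forall n, size (p n) = d) ->
      (forall t : C,
         `|f (t + n%:R) - (p n).[t + n%:R]| @[n --> \oo] --> (0 : C)) ->
      Sg (fun t => f (t + n%:R)) x y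
        - psum (p n \Po ('X + (n%:R)%:P)) x y @[n --> \oo] --> (0 : C)
  }.

Definition summable_set (U : set (C -> C)) : Prop :=
  [/\ U `<=` classF,
      exists Sg, is_fsum U Sg
    & forall Sg Sg', is_fsum U Sg -> is_fsum U Sg' ->
        forall f (x y : C), trans_span U f -> Sg f x y = Sg' f x y].

(* On a summable set, the choice made by xget is immaterial on S(U). *)
Definition fsum (U : set (C -> C)) : (C -> C) -> C -> C -> C :=
  xget (fun _ _ _ => 0) [set Sg | is_fsum U Sg].

Definition has_essence (U : set (C -> C)) (f : C -> C) : Prop :=
  cvg (h^-1 * fsum U f 1 h @[h --> (0 : C)^']).

Definition ess (U : set (C -> C)) (f : C -> C) : C :=
  lim (h^-1 * fsum U f 1 h @[h --> (0 : C)^']).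

End FractionalSums.

(* Main.v *)
(* By (A1), (A2) and (A4), moving both bounds of a sum by 1 changes it in the
   same way as it changes the polynomial sum, so for a polynomial f the
   difference of the two sums is invariant under integer translation; (A6),
   applied with p_n = f, makes it tend to 0 along the integers, hence it
   vanishes.  Thus the essence of x^a is P_a'(0), where P_a is the Faulhaber
   polynomial.  Telescoping (z+1)^(n+1) - z^(n+1) = sum_(k <= n) C(n+1,k) z^k
   gives sum_(k <= n) C(n+1,k) P_k = (X+1)^(n+1) - 1, and the coefficients of X
   in this identity are the Bernoulli recurrence. *)

Require Import Defs.
From mathcomp Require Import all_boot all_order all_algebra.
From mathcomp Require Import complex.
From mathcomp Require Import all_classical all_reals all_analysis.
From mathcomp Require Import ring.

Import Order.TTheory GRing.Theory Num.Theory.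
Import numFieldNormedType.Exports.

Local Open Scope classical_set_scope.
Local Open Scope ring_scope.

Lemma polynomial_eq0_natroots (F : numDomainType) (p : {poly F}) :
  (forall n : nat, p.[n%:R] = 0) -> p = 0.
Proof.
move=> p0; apply: (@roots_geq_poly_eq0 _ _ [seq n%:R | n <- iota 0 (size p)]).
- by apply/allP => _ /mapP[n _ ->]; apply/eqP/p0.
- by rewrite map_inj_uniq ?iota_uniq//; apply: mulrIn; rewrite oner_eq0.
- by rewrite size_map size_iota.
Qed.

Lemma cvg_horner (K : numFieldType) (p : {poly K}) (z : K) :
  p.[x] @[x --> z] --> p.[z].
Proof.
elim/poly_ind: p => [|p c IHp].
  rewrite horner0; under eq_fun do rewrite horner0; exact: (@cvg_cst K 0 K (nbhs z)).
have pX := @cvgM K K (nbhs z) _ (horner p) id _ _ IHp cvg_id.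
rewrite !hornerE; under eq_fun do rewrite !hornerE.
exact: (cvgD (pX _) (@cvg_cst K c K (nbhs z) _)).
Qed.

(** Since 0 is a root, [P] factors as [Q * 'X]; away from 0 the quotient is [Q.[h]], and the product
    rule gives [Q.[0]] as the derivative at 0. *)
Lemma cvg_slope0_horner (K : numFieldType) (P : {poly K}) :
  P.[0] = 0 -> h^-1 * P.[h] @[h --> (0 : K)^'] --> P^`().[0].
Proof.
move=> /eqP /factor_theorem[Q ->].
rewrite subr0 derivM derivX !hornerE.
have /continuous_withinNx : {for 0, continuous (horner Q)}.
  exact: cvg_horner.
apply: cvg_trans; apply: near_eq_cvg; near=> h.
have h0 : h != 0 by near: h; exact: nbhs_dnbhs_neq.
by rewrite hornerMX mulrCA mulVf ?mulr1.
Unshelve. all: by end_near.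
Qed.

Section PolynomialSums.
Local Set Implicit Arguments.
Local Unset Strict Implicit.
Variable R : realType.
Local Notation C := (Cplx R).

(** Convertible to the set from which [psum_primitive] chooses, so that [xgetPex] applies to it. *)
Definition is_primitive (p P : {poly C}) : Prop :=
  (forall z : C, P.[z] - P.[z - 1] = p.[z]) /\ P.[0] = 0.

(** The common value at 0 and the common difference equation force agreement at every natural
    number, hence infinitely many roots of [P - Q]. *)
Lemma is_primitive_uniq (p P Q : {poly C}) :
  is_primitive p P -> is_primitive p Q -> P = Q.
Proof.
move=> [Pp P0] [Qp Q0]; apply/eqP; rewrite -subr_eq0; apply/eqP.
apply: polynomial_eq0_natroots; elim=> [|n IHn]; rewrite !hornerE.
  by rewrite P0 Q0 subrr.
have := Pp n.+1%:R; rewrite -(Qp n.+1%:R).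
have -> : n.+1%:R - 1 = n%:R :> C by rewrite -natr1 addrK.
move: IHn; rewrite !hornerE => /eqP; rewrite subr_eq0 => /eqP ->.
by move/addIr ->; rewrite subrr.
Qed.

Lemma psum_primitiveE (p P : {poly C}) :
  is_primitive p P -> psum_primitive p = P.
Proof.
move=> PP; apply: is_primitive_uniq (PP).
by have := @xgetPex _ 0 (is_primitive p) (ex_intro _ P PP).
Qed.

(** Translation preserves the difference equation; subtracting the constant [P.[c]] restores the
    value 0 at 0. *)
Lemma is_primitive_shift (p P : {poly C}) (c : C) :
  is_primitive p P ->
  is_primitive (p \Po ('X + c%:P)) (P \Po ('X + c%:P) - P.[c]%:P).
Proof.
move=> [Pp P0]; split=> [z|].
  rewrite !horner_comp !hornerE /= !horner_comp !hornerE -(Pp (z + c)).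
  by rewrite (addrAC z); ring.
by rewrite !hornerE /= horner_comp !hornerE subrr.
Qed.

Lemma psum_shift (p P : {poly C}) (c x y : C) :
  is_primitive p P ->
  psum (p \Po ('X + c%:P)) x y = P.[y + c] - P.[x + c - 1].
Proof.
move=> PP; rewrite /psum (psum_primitiveE (is_primitive_shift c PP)).
rewrite !hornerE /= !horner_comp !hornerE (addrAC x).
ring.
Qed.

(* C(n+1,k) X^k summed over k <= n has primitive (X+1)^(n+1) - 1; solving for
   k = n gives the next Faulhaber polynomial from the previous ones. *)
Lemma faulhaber (n : nat) :
  exists2 P : {poly C}, is_primitive 'X^n P & P^`().[0] = ratr (bernoulli n).
Proof.
elim/ltn_ind: n => n IHn.
(* [psum_primitive] serves as a choice function: it names the polynomials whose existence [IHn]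
   asserts, so that they can be summed. *)
pose F k : {poly C} := psum_primitive 'X^k.
have FP k : (k < n)%N -> is_primitive 'X^k (F k) /\ (F k)^`().[0] = ratr (bernoulli k).
  by move=> /IHn[P PP P1]; rewrite /F (psum_primitiveE PP).
have n0 : n.+1%:R != 0 :> C by rewrite pnatr_eq0.
pose S : {poly C} := \sum_(k < n) 'C(n.+1, k)%:R *: F k.
have S_prim (z : C) : S.[z] - S.[z - 1] = \sum_(k < n) 'C(n.+1, k)%:R * z ^+ k.
  rewrite !horner_sum -sumrB; apply: eq_bigr => k _.
  have [[/(_ z) + _] _] := FP k (ltn_ord k).
  by rewrite !hornerZ -mulrBr hornerXn => ->.
have S0 : S.[0] = 0.
  rewrite horner_sum big1// => k _; have [[_ Fk0] _] := FP k (ltn_ord k).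
  by rewrite !hornerE Fk0 mulr0.
exists (n.+1%:R^-1 *: (('X + 1) ^+ n.+1 - 1 - S)).
  split=> [z|].
    have binz : (z + 1) ^+ n.+1 - z ^+ n.+1
        = \sum_(k < n) 'C(n.+1, k)%:R * z ^+ k + n.+1%:R * z ^+ n.
      rewrite (addrC z) exprDn 2!big_ord_recr /= subnn subSnn binn binSn.
      rewrite !expr1n !mul1r mulr1n addrK mulr_natl; congr (_ + _).
      by apply: eq_bigr => k _; rewrite expr1n mul1r mulr_natl.
    rewrite !hornerE -mulrBr subrK; apply: (mulfI n0).
    rewrite mulrA divff// mul1r -[RHS](addKr (\sum_(k < n) 'C(n.+1, k)%:R * z ^+ k)).
    by rewrite -binz -S_prim; ring.
  by rewrite !hornerE S0 expr1n subrr subr0 mulr0.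
have S1 : S^`().[0] = ratr (\sum_(k < n) 'C(n.+1, k)%:R * bernoulli k).
  rewrite /S raddf_sum horner_sum raddf_sum; apply: eq_bigr => k _ /=.
  have [_ Fk1] := FP k (ltn_ord k).
  by rewrite derivZ hornerZ Fk1 rmorphM/= ratr_nat.
rewrite derivZ !derivB deriv_exp derivD derivX derivC addr0 mul1r subr0 /=.
rewrite !hornerE S1 hornerMn !hornerE expr1n; apply: (mulfI n0).
(* Expanding [n.+1%:R] by the Bernoulli recurrence cancels all terms with [k < n] and leaves
   ['C(n.+1, n) * bernoulli n]. *)
rewrite mulrA divff// mul1r -(ratr_nat C n.+1) -rmorphB -rmorphM -[X in X - _]bernoulliP.
by rewrite big_ord_recr /= binSn addrAC subrr add0r.
Qed.

Lemma trans_span_shift (U : set (C -> C)) (f : C -> C) (s : C) :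
  trans_span U f -> trans_span U (fun t => f (t + s)).
Proof.
move=> [n [c [g [Ug ->]]]]; exists n, c, (fun i t => g i (t + s)); split=> // i.
have [h [d [Uh ->]]] := Ug i; exists h, (s + d); split=> //.
by apply/funext => t; rewrite addrA.
Qed.

Section AxiomaticSum.
Variables (U : set (C -> C)) (Sg : (C -> C) -> C -> C -> C).
Hypothesis SgP : is_fsum U Sg.

(** (A2) with shift [x - 1] moves both bounds to 1, where (A4) applies to the translate. *)
Lemma is_fsum_single (f : C -> C) (x : C) : trans_span U f -> Sg f x x = f x.
Proof.
move=> Uf; have /(fsum_A2 SgP) := Uf => /(_ 1 1 (x - 1)).
rewrite (addrC 1) subrK => ->.
by rewrite (fsum_A4 SgP) ?(addrC 1) ?subrK//; exact: trans_span_shift.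
Qed.

(** By (A1), the sum from [x] to [y + 1] can be split after its first term or before its last
    one. *)
Lemma is_fsum_shift1 (f : C -> C) (x y : C) : trans_span U f ->
  Sg f (x + 1) (y + 1) = Sg f x y + f (y + 1) - f x.
Proof.
move=> Uf; have := fsum_A1 SgP x x (y + 1) Uf.
rewrite -(fsum_A1 SgP x y (y + 1) Uf) !is_fsum_single// => <-.
by rewrite addrAC subrr add0r.
Qed.

Lemma is_fsum_poly (p P : {poly C}) (x y : C) :
  is_primitive p P -> trans_span U (horner p) ->
  Sg (horner p) x y = P.[y] - P.[x - 1].
Proof.
move=> PP Up; pose D n : C := Sg (horner p) (x + n%:R) (y + n%:R)
  - (P.[y + n%:R] - P.[x + n%:R - 1]).
have DE n : D n = Sg (horner p) x y - (P.[y] - P.[x - 1]).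
  elim: n => [|n <-]; first by rewrite /D !addr0.
  (* The two boundary values of [p] become differences of [P], which cancel the change in the
     polynomial sum. *)
  rewrite /D -natr1 !addrA is_fsum_shift1// addrK -!(PP.1 (_ + _)) !addrK; ring.
have D0 : D n @[n --> \oo] --> (0 : C).
  have pp t : `|p.[t + n%:R] - p.[t + n%:R]| @[n --> \oo] --> (0 : C).
    by under eq_fun do rewrite subrr normr0; exact: cvg_cst.
  have := @fsum_A6_poly _ _ _ SgP _ x y (size p) (fun=> p) Up (fun=> erefl) pp.
  by under eq_fun do rewrite -(fsum_A2 SgP)// (psum_shift _ _ _ PP).
move: D0; under eq_fun do rewrite DE; move=> D0.
by apply: subr0_eq; apply: norm_cvg_unique D0; exact: cvg_cst.
Qed.

End AxiomaticSum.

End PolynomialSums.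

Theorem theorem4p2p8 (R : realType) (a : nat) (U : set (Cplx R -> Cplx R)) :
  summable_set U ->
  trans_span U (fun x : Cplx R => x ^+ a) ->
  has_essence U (fun x : Cplx R => x ^+ a) /\
  ess U (fun x : Cplx R => x ^+ a) = ratr (bernoulli a).
Proof.
move=> [_ exSg _] Ua; have SgP : is_fsum U (fsum U) := xgetPex _ exSg.
have [P PP <-] := faulhaber R a.
have XE : (fun x : Cplx R => x ^+ a) = horner 'X^a.
  by apply/funext => x; rewrite hornerXn.
have cvP : h^-1 * fsum U (fun x => x ^+ a) 1 h @[h --> (0 : Cplx R)^']
    --> P^`().[0].
  rewrite XE in Ua *.
  (* With lower bound 1 the subtracted term is [P.[1 - 1] = P.[0] = 0], so the sum is just
     [P.[h]]. *)
  under eq_fun do rewrite (is_fsum_poly SgP _ _ PP)// subrr PP.2 subr0.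
  exact: cvg_slope0_horner PP.2.
by split; [exact: cvgP cvP|exact: norm_cvg_lim cvP].
Qed.
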